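(* For any $n\ge3$, the transformations $R_{i,i+1}$, $1\le i\le n-1$, of $n\times n$ matrices $\mathcal D=(G_{i,j})_{i,j=1}^n$ satisfy the braid group relation $$R_{i-1,i}R_{i,i+1}R_{i-1,i}\mathcal D=R_{i,i+1}R_{i-1,i}R_{i,i+1}\mathcal D,\qquad 2\le i\le n-1.$$
   Context: The $G_{i,j}$, $i,j=1,\dots,n$, are commuting quantities (the geodesic functions of the $D_n$-algebra, i.e. of the annulus with $n$ marked points on one boundary component). The transformation $R_{i,i+1}$ sends $\mathcal D$ to $\tilde{\mathcal D}=(\tilde G_{i,j})$, where for all $k\ne i,i+1$ $$\tilde G_{i+1,k}=G_{i,k},\qquad \tilde G_{i,k}=G_{i,k}G_{i,i+1}-G_{i+1,k},\qquad \tilde G_{k,i+1}=G_{k,i},\qquad \tilde G_{k,i}=G_{k,i}G_{i,i+1}-G_{k,i+1},$$ and $$\tilde G_{i,i+1}=G_{i,i+1},\qquad \tilde G_{i+1,i+1}=G_{i,i},\qquad \tilde G_{i,i}=G_{i,i}G_{i,i+1}-G_{i+1,i+1},$$ $$\tilde G_{i+1,i}=G_{i+1,i}+G_{i,i+1}G_{i,i}^2-2G_{i,i}G_{i+1,i+1},$$ all other entries being unchanged. In a product of transformations each subsequent transformation is applied to the matrix obtained at the previous step (so its formulas use the transformed entries). *)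

(* Defs.v *)
(* MathComp *)
From HB Require Import structures.
From mathcomp Require Import all_boot all_order all_algebra.

Set Implicit Arguments.
Unset Strict Implicit.
Unset Printing Implicit Defensive.

Import GRing.Theory.
Local Open Scope ring_scope.

(* The transformations R_{i,i+1}, 1 <= i <= n-1, are indexed from 0 by
   'I_n.-1: the index i stands for rows and columns i and i+1 of 'I_n. *)
Definition braid_lo (n : nat) (i : 'I_n.-1) : 'I_n := widen_ord (leq_pred n) i.

Lemma braid_hi_subproof (n : nat) (i : 'I_n.-1) : (i.+1 < n)%N.
Proof. by rewrite -ltn_predRL. Qed.

Definition braid_hi (n : nat) (i : 'I_n.-1) : 'I_n :=
  Ordinal (braid_hi_subproof i).

(* The G_{i,j} are commuting quantities: D is any matrix over a commutative
   ring, and is not assumed symmetric.  Below a and b stand for i and i+1. *)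
Definition braidR (R : comPzRingType) (n : nat) (i : 'I_n.-1)
    (D : 'M[R]_n) : 'M[R]_n :=
  let a := braid_lo i in
  let b := braid_hi i in
  \matrix_(k, l)
    if k == a then
      if l == a then D a a * D a b - D b b
      else if l == b then D a b
      else D a l * D a b - D b l
    else if k == b then
      if l == a then D b a + D a b * D a a ^+ 2 - 2%:R * D a a * D b b
      else if l == b then D a a
      else D a l
    else
      if l == a then D k a * D a b - D k b
      else if l == b then D k a
      else D k l.

(* Main.v *)
Require Import Defs.
From HB Require Import structures.
From mathcomp Require Import all_boot all_order all_algebra.
From mathcomp Require Import ring zify.

Set Implicit Arguments.
Unset Strict Implicit.
Unset Printing Implicit Defensive.

Import GRing.Theory.
Local Open Scope ring_scope.

(** In suitable coordinates R_{i,i+1} is the action of a matrix, which depends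
    on D through the single entry D_{i,i+1}; the braid relation then becomes an
    identity between products of three matrices.

    Write a, b for the two rows i, i+1, let g = D_{a,b}, and let T be the
    identity matrix with its (a,b) diagonal block replaced by
    [[g, -1], [1, 0]].  Away from the (a,b) block, R_{i,i+1} is visibly
    D |-> T D T^T, and the diagonal d of D is sent to T d.  The entries inside
    the block are explained by two facts.  First, that 2x2 block of T has
    determinant 1, so T preserves the (a,b) entry of any skew matrix: the part
    of D above the diagonal, completed to a skew matrix X, is sent to T X T^T
    with X_{a,b} = g fixed.  Second, the quadratic formula for the new
    D_{b,a} says exactly that w_{a,b} = D_{a,b} + D_{b,a} - d_a d_b is
    invariant, so w, made skew in the same way into a matrix W, is sent to
    T W T^T.  The triple (X, W, d) determines D (skew_coord_inj), so D is
    transformed by letting T act on X, W and d (skew_braidR,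
    skew_defect_braidR, diag_col_braidR).

    Each side of the braid relation therefore acts by a product of three
    matrices T, and it suffices that these products agree
    (braid_turn_braid).  With x, y, z the entries of D at (a,b), (b,c),
    (a,c), where c = i+2, the parameters g met along the two words are
    x, z, y and y, xy - z, x, and the products agree by turn_braid. *)

(** The identity with the block [[g, -1], [1, 0]] on rows and columns a, b.
    It is given by rows so that a product with it can be read off row by
    row. *)
Definition turn (R : comPzRingType) (n : nat) (a b : 'I_n) (g : R) : 'M[R]_n :=
  \matrix_(k < n) if k == a then g *: delta_mx 0 a - delta_mx 0 b
                  else if k == b then delta_mx 0 a else delta_mx 0 k.

Lemma turn_mulE (R : comPzRingType) (n m : nat) (a b : 'I_n) (g : R)
    (A : 'M[R]_(n, m)) k l :
  (turn a b g *m A) k l =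
    if k == a then g * A a l - A b l else if k == b then A a l else A k l.
Proof.
have -> : (turn a b g *m A) k l = row k (turn a b g *m A) 0 l.
  by rewrite [RHS]mxE.
rewrite row_mul rowK; case: ifP => _; last by case: ifP => _; rewrite -rowE mxE.
by rewrite mulmxBl -scalemxAl -!rowE !mxE.
Qed.

Lemma turn_conjE (R : comPzRingType) (n : nat) (a b : 'I_n) (g : R)
    (A : 'M[R]_n) k l :
  (turn a b g *m A *m (turn a b g)^T) k l =
    if l == a then g * (turn a b g *m A) k a - (turn a b g *m A) k b
    else if l == b then (turn a b g *m A) k a else (turn a b g *m A) k l.
Proof.
rewrite -[_ *m _^T]trmxK [LHS]mxE trmx_mul trmxK [LHS]turn_mulE.
by rewrite ![(_ *m _)^T _ _]mxE.
Qed.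

(** With e_k the basis rows, both products have the rows
    (xy - z) e_a - y e_b + e_c, x e_a - e_b and e_a in positions a, b, c. *)
Lemma turn_braid (R : comPzRingType) (n : nat) (a b c : 'I_n) (x y z : R) :
  a != b -> b != c -> a != c ->
  turn a b y *m turn b c z *m turn a b x
    = turn b c x *m turn a b (x * y - z) *m turn b c y.
Proof.
move=> ab bc ac; rewrite -[LHS]mulmx1 -[RHS]mulmx1 -!mulmxA.
have sep := (negPf ab, negPf bc, negPf ac, eq_sym b a, eq_sym c b, eq_sym c a).
apply/matrixP => k l.
have [->|/negPf ka] := eqVneq k a; last have [->|/negPf kb] := eqVneq k b;
  last have [->|/negPf kc] := eqVneq k c;
  by rewrite !turn_mulE ?(sep, eqxx) ?(ka, kb, kc) //; ring.
Qed.

(** Skew completion of the strictly upper triangular part.  The sign matters: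
    the block of a turn has determinant 1, so conjugation by it fixes the
    (a,b) entry of a skew matrix, as R_{i,i+1} fixes D_{a,b}. *)
Definition skew (R : comPzRingType) (n : nat) (A : 'M[R]_n) : 'M[R]_n :=
  \matrix_(k, l) if (k < l)%N then A k l else if (l < k)%N then - A l k else 0.

Lemma skewE (R : comPzRingType) (n : nat) (A : 'M[R]_n) k l :
  skew A k l =
    if (k < l)%N then A k l else if (l < k)%N then - A l k else 0.
Proof. by rewrite mxE. Qed.

(** The criterion behind both skew coordinates: the rule for entries with one
    index outside {a, b} is linear and the (a,b) entry is fixed.  Adjacency
    b = a + 1 ensures that every other index lies on the same side of a and
    of b, so that mixing rows a and b does not mix entries above the diagonal
    with entries below it. *)
Lemma skew_turn (R : comPzRingType) (n : nat) (a b : 'I_n) (g : R)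
    (A B : 'M[R]_n) :
  b = a.+1 :> nat -> B a b = A a b ->
  (forall l, l != a -> l != b ->
    [/\ B a l = g * A a l - A b l, B b l = A a l,
        B l a = g * A l a - A l b & B l b = A l a]) ->
  (forall k l, k != a -> k != b -> l != a -> l != b -> B k l = A k l) ->
  skew B = turn a b g *m skew A *m (turn a b g)^T.
Proof.
move=> ba Bab Bout Bfix; apply/matrixP => k l.
have ab : (a < b)%N by rewrite ba.
have ab' : (a == b) = false by rewrite -val_eqE ltn_eqF.
have ba' : (b == a) = false by rewrite eq_sym.
have bNa : (b < a)%N = false by rewrite ltnNge ltnW.
have out t : t != a -> t != b -> ((t < b) = (t < a))%N /\ ((b < t) = (a < t))%N.
  by rewrite -!val_eqE /=; lia.
rewrite turn_conjE !turn_mulE.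
have [->|ka] := eqVneq k a; [|have [->|kb] := eqVneq k b];
  (have [->|la] := eqVneq l a; [|have [->|lb] := eqVneq l b]);
  rewrite ?(ab', ba', eqxx) !skewE ?(ltnn, ab, bNa) ?Bab ?mulr0 //; try ring.
- have [-> ->] := out _ la lb; have [-> _ -> _] := Bout _ la lb.
  by case: ifP => _; [|case: ifP => _]; ring.
- have [-> ->] := out _ la lb; have [_ -> _ ->] := Bout _ la lb.
  by [].
- have [-> ->] := out _ ka kb; have [-> _ -> _] := Bout _ ka kb.
  by case: ifP => _; [|case: ifP => _]; ring.
- have [-> ->] := out _ ka kb; have [_ -> _ ->] := Bout _ ka kb.
  by [].
- by rewrite !Bfix.
Qed.

Definition diag_col (R : comPzRingType) (n : nat) (D : 'M[R]_n) : 'cV[R]_n :=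
  \col_k D k k.

(** D + D^T - d d^T with d the diagonal of D: the symmetric combination whose
    (i,i+1) entry R_{i,i+1} leaves invariant. *)
Definition defect (R : comPzRingType) (n : nat) (D : 'M[R]_n) : 'M[R]_n :=
  D + D^T - diag_col D *m (diag_col D)^T.

Lemma defectE (R : comPzRingType) (n : nat) (D : 'M[R]_n) k l :
  defect D k l = D k l + D l k - D k k * D l l.
Proof. by rewrite !mxE big_ord1 !mxE. Qed.

(** For k < l, the entry D_{l,k} is w_{k,l} - D_{k,l} + d_k d_l, and
    D_{k,l}, d_k, d_l are known from the first and the last
    coordinate. *)
Lemma skew_coord_inj (R : comPzRingType) (n : nat) (D E : 'M[R]_n) :
  skew D = skew E -> skew (defect D) = skew (defect E) ->
  diag_col D = diag_col E -> D = E.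
Proof.
move=> /matrixP eqX /matrixP eqW /matrixP eqd.
have dE k : D k k = E k k by have := eqd k 0; rewrite !mxE.
have up (k l : 'I_n) : (k < l)%N -> D k l = E k l.
  by move=> kl; have := eqX k l; rewrite !skewE kl.
have low (k l : 'I_n) : (k < l)%N -> D l k = E l k.
  move=> kl; have := eqW k l; rewrite !skewE kl !defectE !dE up //.
  by move/addIr/addrI.
apply/matrixP => k l.
by case: (ltngtP k l) => [/up|/low|/val_inj ->].
Qed.

Definition braid_turn (R : comPzRingType) (n : nat) (i : 'I_n.-1)
    (D : 'M[R]_n) : 'M[R]_n :=
  turn (braid_lo i) (braid_hi i) (D (braid_lo i) (braid_hi i)).

Lemma braid_lo_neq_hi (n : nat) (i : 'I_n.-1) : braid_lo i != braid_hi i.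
Proof. by rewrite -val_eqE /= ltn_eqF. Qed.

Lemma skew_braidR (R : comPzRingType) (n : nat) (i : 'I_n.-1) (D : 'M[R]_n) :
  skew (braidR i D) = braid_turn i D *m skew D *m (braid_turn i D)^T.
Proof.
have hi_lo := negPf (braid_lo_neq_hi i); rewrite eq_sym in hi_lo.
apply: skew_turn => //; first by rewrite mxE !eqxx hi_lo.
  move=> l /negPf la /negPf lb.
  by rewrite !mxE !eqxx hi_lo la lb; split=> //; ring.
move=> k l /negPf ka /negPf kb /negPf la /negPf lb.
by rewrite mxE ka kb la lb.
Qed.

(** The (a,b) entry is where the quadratic formula for the new D_{b,a} enters:
    with g = D_{a,b}, one has
    g + (D_{b,a} + g d_a^2 - 2 d_a d_b) - (g d_a - d_b) d_a
      = g + D_{b,a} - d_a d_b. *)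
Lemma skew_defect_braidR (R : comPzRingType) (n : nat) (i : 'I_n.-1)
    (D : 'M[R]_n) :
  skew (defect (braidR i D))
    = braid_turn i D *m skew (defect D) *m (braid_turn i D)^T.
Proof.
have hi_lo := negPf (braid_lo_neq_hi i); rewrite eq_sym in hi_lo.
apply: skew_turn => //.
- by rewrite !defectE !mxE !eqxx hi_lo; ring.
- move=> l /negPf la /negPf lb.
  by rewrite !defectE !mxE !eqxx hi_lo la lb; split; ring.
- move=> k l /negPf ka /negPf kb /negPf la /negPf lb.
  by rewrite !defectE !mxE ka kb la lb.
Qed.

Lemma diag_col_braidR (R : comPzRingType) (n : nat) (i : 'I_n.-1)
    (D : 'M[R]_n) :
  diag_col (braidR i D) = braid_turn i D *m diag_col D.
Proof.
apply/matrixP => k l; rewrite turn_mulE !mxE.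
by case: eqP => _; [ring | case: eqP].
Qed.

(** The left factors carry the parameters y, z, x and the right ones
    x, xy - z, y, where x, y, z are the entries of D at (i,i+1), (i+1,i+2),
    (i,i+2): R_{i,i+1} moves z to (i+1,i+2) and zx - y to (i,i+2), after which
    R_{i+1,i+2} puts x z - (z x - y) = y at (i,i+1); on the other side,
    R_{i+1,i+2} puts xy - z at (i,i+1) and x at (i,i+2), and R_{i,i+1} moves
    this x to (i+1,i+2). *)
Lemma braid_turn_braid (R : comPzRingType) (n : nat) (i j : 'I_n.-1)
    (D : 'M[R]_n) :
  j = i.+1 :> nat ->
  braid_turn i (braidR j (braidR i D)) *m braid_turn j (braidR i D)
      *m braid_turn i D
    = braid_turn j (braidR i (braidR j D)) *m braid_turn i (braidR j D)
      *m braid_turn j D.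
Proof.
move=> hij.
have hi_lo : braid_hi i = braid_lo j by apply: val_inj; rewrite /= hij.
have ab := braid_lo_neq_hi i; have bc := braid_lo_neq_hi j.
have ac : braid_lo i != braid_hi j by rewrite -val_eqE /= hij ltn_eqF.
rewrite hi_lo in ab.
rewrite /braid_turn !(mxE, hi_lo).
(* With the indices abstracted, every test between them reduces by [sep]. *)
move: (braid_lo i) (braid_lo j) (braid_hi j) ab bc ac => a b c ab bc ac.
have sep := (negPf ab, negPf bc, negPf ac, eq_sym b a, eq_sym c b, eq_sym c a).
rewrite ?(sep, eqxx) -turn_braid //.
by congr (turn a b _ *m _ *m _); ring.
Qed.

Theorem lemma7 (R : comPzRingType) (n : nat) (hn : (3 <= n)%N)
    (i j : 'I_n.-1) (hij : j = i.+1 :> nat) (D : 'M[R]_n) :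
  braidR i (braidR j (braidR i D)) = braidR j (braidR i (braidR j D)).
Proof.
pose word (p q r : 'I_n.-1) := braid_turn p (braidR q (braidR r D))
  *m braid_turn q (braidR r D) *m braid_turn r D.
have skewE3 p q r : skew (braidR p (braidR q (braidR r D)))
    = word p q r *m skew D *m (word p q r)^T.
  by rewrite 3!skew_braidR !trmx_mul !mulmxA.
have defectE3 p q r : skew (defect (braidR p (braidR q (braidR r D))))
    = word p q r *m skew (defect D) *m (word p q r)^T.
  by rewrite 3!skew_defect_braidR !trmx_mul !mulmxA.
have diagE3 p q r : diag_col (braidR p (braidR q (braidR r D)))
    = word p q r *m diag_col D.
  by rewrite 3!diag_col_braidR !mulmxA.
have wordE : word i j i = word j i j := braid_turn_braid D hij.
apply: skew_coord_inj.
- by rewrite [LHS]skewE3 [RHS]skewE3 wordE.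
- by rewrite [LHS]defectE3 [RHS]defectE3 wordE.
- by rewrite [LHS]diagE3 [RHS]diagE3 wordE.
Qed.
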